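(* Let $\Sigma=\{a,b\}$ and let $\lambda^{\rm safe}\mathrm{def}$ denote the minimal set of word functions $(\Sigma^* )^n\to\Sigma^*$ ($n\ge1$) that contains (i) the projections, (ii) the constant functions, (iii) concatenation $\mathrm{app}$, (iv) substitution $\mathrm{sub}$, and is closed under composition. Then the set of word functions definable in the safe lambda calculus (i.e. represented by a closed safe term) is precisely $\lambda^{\rm safe}\mathrm{def}$.
   Context: Simple types are generated by $A ::= o \mid A \to A$ ($\to$ associates to the right); $(A_1,\ldots,A_n,B)$ abbreviates $A_1\to\cdots\to A_n\to B$. Orders: $\mathrm{ord}(o)=0$, $\mathrm{ord}(A\to B)=\max(\mathrm{ord}(A)+1,\mathrm{ord}(B))$. Terms are Church-style terms built from typed variables, without constants. The order of a term or variable is the order of its type. Safe lambda calculus. Judgements $\Gamma\vdash_{\sf s} M:A$ and $\Gamma\vdash_{\sf asa} M:A$ are defined by mutual induction. ''$c\le \mathrm{ord}\,\Gamma$'' means $c\le \mathrm{ord}(y)$ for every $y\in\Gamma$. (var) $x:A\vdash_{\sf s}x:A$. (wk) from $\Gamma\vdash_{\sf s}M:A$ infer $\Delta\vdash_{\sf s}M:A$ if $\Gamma\subset\Delta$. ($\delta$) from $\Gamma\vdash_{\sf s}M:A$ infer $\Gamma\vdash_{\sf asa}M:A$. (app$_{as}$) from $\Gamma\vdash_{\sf asa}M:A\to B$ and $\Gamma\vdash_{\sf s}N:A$ infer $\Gamma\vdash_{\sf asa}MN:B$. (app) from $\Gamma\vdash_{\sf asa}M:A\to B$ and $\Gamma\vdash_{\sf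 s}N:A$ infer $\Gamma\vdash_{\sf s}MN:B$, provided $\mathrm{ord}(B)\le\mathrm{ord}\,\Gamma$. (abs) from $\Gamma,x_1:A_1,\ldots,x_n:A_n\vdash_{\sf asa}M:B$ infer $\Gamma\vdash_{\sf s}\lambda x_1^{A_1}\ldots x_n^{A_n}.M:(A_1,\ldots,A_n,B)$, provided $\mathrm{ord}(A_1,\ldots,A_n,B)\le\mathrm{ord}\,\Gamma$. A term $M$ is safe if $\Gamma\vdash_{\sf s}M:T$ is derivable for some $\Gamma,T$. Word functions. $\mathrm{app}(x,y)$ is the concatenation of $x$ and $y$. $\mathrm{sub}:(\Sigma^* )^3\to\Sigma^*$ is given by $\mathrm{sub}(\epsilon,y,z)=\epsilon$, $\mathrm{sub}(ax,y,z)=\mathrm{app}(y,\mathrm{sub}(x,y,z))$, $\mathrm{sub}(bx,y,z)=\mathrm{app}(z,\mathrm{sub}(x,y,z))$. Projections: $\pi_k(x_1,\ldots,x_n)=x_k$ for $1\le k\le n$. Constant functions: $\mathrm{cst}_w:\Sigma^*\to\Sigma^*$, $x\mapsto w$, for $w\in\Sigma^*$. Closed under composition: with $g:(\Sigma^* )^n\to\Sigma^*$ and $f_1,\ldots,f_n:(\Sigma^* )^p\to\Sigma^*$ the set contains $(x_1,\ldots,x_p)\mapsto g(f_1(x_1,\ldots,x_p),\ldots,f_n(x_1,\ldots,x_p))$. Representation. Let $\mathbf{B}=(o\to o)\to(o\to o)\to o\to o$. Each word $w$ is encoded by a closed term $\underline{w}:\mathbf{B}$: $\underline{\epsilon}=\lambda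 u^{o\to o}v^{o\to o}x^o.x$, $\underline{a\cdot w}=\lambda u v x.u(\underline{w}\,u\,v\,x)$, $\underline{b\cdot w}=\lambda u v x.v(\underline{w}\,u\,v\,x)$ (up to $\beta\eta$-equality). A word function $h:(\Sigma^* )^n\to\Sigma^*$ is represented by a closed term $H:\mathbf{B}^n\to\mathbf{B}$ (i.e. $\mathbf{B}\to\cdots\to\mathbf{B}\to\mathbf{B}$ with $n$ arguments) if $H\,\underline{x_1}\ldots\underline{x_n}=_{\beta\eta}\underline{h(x_1,\ldots,x_n)}$ for all $x_1,\ldots,x_n\in\Sigma^*$. *)

(* Defs.v *)
From mathcomp Require Import all_boot.
Set Implicit Arguments. Unset Strict Implicit. Unset Printing Implicit Defensive.

Inductive ty : Type := Base | Arr (A B : ty).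

(* [arrows [:: A_1; ...; A_n] B] is the type (A_1, ..., A_n, B). *)
Definition arrows (As : seq ty) (B : ty) : ty := foldr Arr B As.

Fixpoint ord (A : ty) : nat :=
  if A is Arr A1 A2 then maxn (ord A1).+1 (ord A2) else 0.

(* Church-style terms up to alpha-conversion, with de Bruijn indices. *)
Inductive tm : Type := Var (x : nat) | App (M N : tm) | Lam (A : ty) (M : tm).

Definition apps (M : tm) (Ns : seq tm) : tm := foldl App M Ns.

(* lambda x_1^{A_1} ... x_n^{A_n}. M; in M the index of x_n is 0. *)
Definition lams (As : seq ty) (M : tm) : tm := foldr Lam M As.

Definition up_ren (r : nat -> nat) (x : nat) : nat :=
  if x is y.+1 then (r y).+1 else 0.

Fixpoint rename (r : nat -> nat) (M : tm) : tm :=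
  match M with
  | Var x => Var (r x)
  | App M N => App (rename r M) (rename r N)
  | Lam A M => Lam A (rename (up_ren r) M)
  end.

Definition up_subst (s : nat -> tm) (x : nat) : tm :=
  if x is y.+1 then rename succn (s y) else Var 0.

Fixpoint subst (s : nat -> tm) (M : tm) : tm :=
  match M with
  | Var x => s x
  | App M N => App (subst s M) (subst s N)
  | Lam A M => Lam A (subst (up_subst s) M)
  end.

Definition subst1 (N M : tm) : tm :=
  subst (fun x => if x is y.+1 then Var y else N) M.

(* A context is a finite set of typed variables.  The entry at position x is
   [Some A] when the context contains x : A, and [None] when x is not declared;
   positions beyond the end of the list are not declared either.  Thanks to the
   undeclared positions, inclusion of contexts involves no renaming of terms. *)
Definition ctx : Type := seq (option ty).

Definition lookup (G : ctx) (x : nat) : option ty := nth None G x.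

Definition ctx1 (x : nat) (A : ty) : ctx := ncons x None [:: Some A].

Definition ctx_sub (G D : ctx) : Prop :=
  forall x A, lookup G x = Some A -> lookup D x = Some A.

(* Gamma, x_1 : A_1, ..., x_n : A_n under the binders of [lams As]. *)
Definition ctx_ext (G : ctx) (As : seq ty) : ctx := rev (map Some As) ++ G.

(* c <= ord Gamma *)
Definition le_ord (c : nat) (G : ctx) : Prop :=
  forall x A, lookup G x = Some A -> c <= ord A.

Inductive has_type : ctx -> tm -> ty -> Prop :=
| ht_var G x A : lookup G x = Some A -> has_type G (Var x) A
| ht_app G M N A B :
    has_type G M (Arr A B) -> has_type G N A -> has_type G (App M N) B
| ht_lam G M A B :
    has_type (ctx_ext G [:: A]) M B -> has_type G (Lam A M) (Arr A B).

(* Beta-eta-equality of terms of type A in context G. *)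
Inductive beta_eta : ctx -> tm -> tm -> ty -> Prop :=
| be_refl G M A : has_type G M A -> beta_eta G M M A
| be_sym G M N A : beta_eta G M N A -> beta_eta G N M A
| be_trans G M N P A :
    beta_eta G M N A -> beta_eta G N P A -> beta_eta G M P A
| be_app G M M' N N' A B :
    beta_eta G M M' (Arr A B) -> beta_eta G N N' A ->
    beta_eta G (App M N) (App M' N') B
| be_lam G M M' A B :
    beta_eta (ctx_ext G [:: A]) M M' B ->
    beta_eta G (Lam A M) (Lam A M') (Arr A B)
| be_beta G M N A B :
    has_type (ctx_ext G [:: A]) M B -> has_type G N A ->
    beta_eta G (App (Lam A M) N) (subst1 N M) B
| be_eta G M A B :
    has_type G M (Arr A B) ->
    beta_eta G (Lam A (App (rename succn M) (Var 0))) M (Arr A B).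

Inductive safe : ctx -> tm -> ty -> Prop :=
| safe_var x A : safe (ctx1 x A) (Var x) A
| safe_wk G D M A : ctx_sub G D -> safe G M A -> safe D M A
| safe_app G M N A B :
    asafe G M (Arr A B) -> safe G N A -> le_ord (ord B) G ->
    safe G (App M N) B
| safe_abs G As M B :
    0 < size As -> asafe (ctx_ext G As) M B -> le_ord (ord (arrows As B)) G ->
    safe G (lams As M) (arrows As B)
with asafe : ctx -> tm -> ty -> Prop :=
| asafe_delta G M A : safe G M A -> asafe G M A
| asafe_app G M N A B :
    asafe G M (Arr A B) -> safe G N A -> asafe G (App M N) B.

Definition safe_term (M : tm) : Prop := exists G A, safe G M A.

Inductive letter : Type := La | Lb.

Definition word : Type := seq letter.

Definition word_fun (n : nat) : Type := n.-tuple word -> word.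

Fixpoint sub (x y z : word) : word :=
  match x with
  | [::] => [::]
  | La :: x' => y ++ sub x' y z
  | Lb :: x' => z ++ sub x' y z
  end.

(* [lsd_ext] expresses that word functions are compared pointwise, so that the
   class is a set of functions without appeal to functional extensionality. *)
Inductive lambda_safe_def : forall n : nat, word_fun n -> Prop :=
| lsd_proj n (k : 'I_n) : lambda_safe_def (fun xs : n.-tuple word => tnth xs k)
| lsd_cst (w : word) : lambda_safe_def (fun _ : 1.-tuple word => w)
| lsd_app :
    lambda_safe_def (fun xs : 2.-tuple word => nth [::] xs 0 ++ nth [::] xs 1)
| lsd_sub :
    lambda_safe_def (fun xs : 3.-tuple word =>
      sub (nth [::] xs 0) (nth [::] xs 1) (nth [::] xs 2))
| lsd_comp n p (g : word_fun n) (f : 'I_n -> word_fun p) :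
    0 < n -> 0 < p ->
    lambda_safe_def g -> (forall i, lambda_safe_def (f i)) ->
    lambda_safe_def (fun xs : p.-tuple word => g [tuple f i xs | i < n])
| lsd_ext n (f g : word_fun n) :
    f =1 g -> lambda_safe_def f -> lambda_safe_def g.

Definition oo : ty := Arr Base Base.

Definition word_ty : ty := arrows [:: oo; oo; Base] Base.

(* Under the binders u, v, x the indices are u = 2, v = 1, x = 0.  The encoding
   of the tail is closed, so it needs no lifting. *)
Fixpoint enc (w : word) : tm :=
  lams [:: oo; oo; Base]
    match w with
    | [::] => Var 0
    | La :: w' => App (Var 2) (apps (enc w') [:: Var 2; Var 1; Var 0])
    | Lb :: w' => App (Var 1) (apps (enc w') [:: Var 2; Var 1; Var 0])
    end.

(* A term is closed and of type A when it has type A in the empty context. *)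
Definition represents (n : nat) (H : tm) (h : word_fun n) : Prop :=
  has_type [::] H (arrows (nseq n word_ty) word_ty) /\
  forall xs : n.-tuple word,
    beta_eta [::] (apps H (map enc xs)) (enc (h xs)) word_ty.

Definition safe_definable (n : nat) (h : word_fun n) : Prop :=
  exists H : tm, safe_term H /\ represents H h.

(* Main.v *)
(* Ground types are interpreted by words, so that beta-eta-equal terms have equal
   values and [enc w] iterates its two arguments along [w].

   Safe implies class.  Evaluate H on the family of all argument tuples at once.
   A family at ground type is good relative to a set S of tails when it has the
   form p ++ s with p in the class and s in S.  Safety forces an argument of
   order at least 1 to have no free variables of order 0, so such arguments may be
   required to be good relative to every S.  At type o -> o this uniformity leaves
   only the maps t |-> p ++ t, and iterating two of these along the k-th argument
   is sub (x_k, p, q) followed by a concatenation.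

   Class implies safe.  Each generator and each composite is given by an explicit
   safe term; its value is computed in the model, and a logical relation between
   terms and values shows that closed terms of type [word_ty] with the same value
   are beta-eta-equal. *)
Require Import Defs.
From mathcomp Require Import all_boot.
From Stdlib Require List.
From Stdlib Require Import FunctionalExtensionality Eqdep_dec.

Set Implicit Arguments. Unset Strict Implicit. Unset Printing Implicit Defensive.

(** * Free variables, renaming, substitution and typing *)

Fixpoint free (x : nat) (M : tm) : Prop :=
  match M with
  | Var y => x = y
  | App M N => free x M \/ free x N
  | Lam _ M => free x.+1 M
  end.

Lemma has_type_free G M A x :
  has_type G M A -> free x M -> exists B, lookup G x = Some B.
Proof.
move=> hM; elim: hM x => {G M A} /=.
- by move=> G y A hy x ->; exists A.
- by move=> G M N A B _ IHM _ IHN x [/IHM|/IHN].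
- by move=> G M A B _ IH x /IH.
Qed.

Lemma closed_free M A x : has_type [::] M A -> ~ free x M.
Proof. by move=> hM /(has_type_free hM) [B]; rewrite /lookup nth_nil. Qed.

(** Only the free variables constrain [r], so this covers lifting a closed term as well as weakening
    by the identity. *)
Lemma rename_fix r M : (forall x, free x M -> r x = x) -> rename r M = M.
Proof.
elim: M r => [x|M IHM N IHN|A M IH] r hr /=; first by rewrite hr.
- by rewrite IHM ?IHN // => x hx; apply: hr => /=; tauto.
- by rewrite IH // => -[|x] //= hx; rewrite hr.
Qed.

Lemma subst_fix s M : (forall x, free x M -> s x = Var x) -> subst s M = M.
Proof.
elim: M s => [x|M IHM N IHN|A M IH] s hs /=; first by rewrite hs.
- by rewrite IHM ?IHN // => x hx; apply: hs => /=; tauto.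
- by rewrite IH // => -[|x] //= hx; rewrite hs.
Qed.

Lemma subst_ext s t M : s =1 t -> subst s M = subst t M.
Proof.
elim: M s t => [x|M IHM N IHN|A M IH] s t hst //=.
- by rewrite (IHM _ t) // (IHN _ t).
- by rewrite (IH _ (up_subst t)) // => -[|x] //=; rewrite hst.
Qed.

Lemma rename_rename r r' M : rename r (rename r' M) = rename (r \o r') M.
Proof.
have ext : forall M q q', q =1 q' -> rename q M = rename q' M.
  elim=> [x|P IHP N IHN|A P IH] q q' h /=; first by rewrite h.
    by rewrite (IHP _ q') // (IHN _ q').
  by rewrite (IH _ (up_ren q')) // => -[|x] //=; rewrite h.
elim: M r r' => [x|M IHM N IHN|A M IH] r r' //=; first by rewrite IHM IHN.
by rewrite IH; congr Lam; apply: ext => -[].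
Qed.

Lemma subst_rename s r M : subst s (rename r M) = subst (s \o r) M.
Proof.
elim: M s r => [x|M IHM N IHN|A M IH] s r //=; first by rewrite IHM IHN.
by rewrite IH; congr Lam; apply: subst_ext => -[].
Qed.

Lemma rename_subst r s M : rename r (subst s M) = subst (rename r \o s) M.
Proof.
elim: M s r => [x|M IHM N IHN|A M IH] s r //=; first by rewrite IHM IHN.
rewrite IH; congr Lam; apply: subst_ext => -[|x] //=.
by rewrite !rename_rename.
Qed.

Lemma subst_subst t s M : subst t (subst s M) = subst (subst t \o s) M.
Proof.
elim: M s t => [x|M IHM N IHN|A M IH] s t //=; first by rewrite IHM IHN.
rewrite IH; congr Lam; apply: subst_ext => -[|x] //=.
by rewrite subst_rename rename_subst; apply: subst_ext.
Qed.

Definition scons (N : tm) (s : nat -> tm) (x : nat) : tm :=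
  if x is y.+1 then s y else N.

Lemma subst1_up_subst N s M : subst1 N (subst (up_subst s) M) = subst (scons N s) M.
Proof.
rewrite /subst1 subst_subst; apply: subst_ext => -[|x] //=.
by rewrite subst_rename; apply: subst_fix.
Qed.

Lemma has_type_rename G D r M A :
  has_type D M A ->
  (forall x B, lookup D x = Some B -> lookup G (r x) = Some B) ->
  has_type G (rename r M) A.
Proof.
move=> hM; elim: hM G r => {D M A} /=.
- by move=> D x A hx G r hr; apply/ht_var/hr.
- by move=> D M N A B _ IHM _ IHN G r hr; apply: ht_app (IHM _ _ hr) (IHN _ _ hr).
- move=> D M A B _ IH G r hr; apply: ht_lam; apply: IH => -[|x] C //=.
  exact: hr.
Qed.

Lemma has_type_weak G D M A : ctx_sub G D -> has_type G M A -> has_type D M A.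
Proof.
by move=> hGD hM; rewrite -(@rename_fix id M) //; apply: has_type_rename hM _.
Qed.

Lemma has_type_closed G M A : has_type [::] M A -> has_type G M A.
Proof. by apply: has_type_weak => x B; rewrite /lookup nth_nil. Qed.

Lemma has_type_subst G D s M A :
  has_type D M A ->
  (forall x B, lookup D x = Some B -> has_type G (s x) B) ->
  has_type G (subst s M) A.
Proof.
move=> hM; elim: hM G s => {D M A} /=.
- by move=> D x A hx G s; apply.
- by move=> D M N A B _ IHM _ IHN G s hs; apply: ht_app (IHM _ _ hs) (IHN _ _ hs).
- move=> D M A B _ IH G s hs; apply: ht_lam; apply: IH => -[|x] C /= hx.
    exact: ht_var.
  by apply: has_type_rename (hs _ _ hx) _.
Qed.

Lemma has_type_subst1 G N M A B :
  has_type (ctx_ext G [:: A]) M B -> has_type G N A -> has_type G (subst1 N M) B.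
Proof.
move=> hM hN; apply: has_type_subst hM _ => -[|x] C /=; first by case=> <-.
exact: ht_var.
Qed.

Lemma has_type_eta G M A B :
  has_type G M (Arr A B) ->
  has_type G (Lam A (App (rename succn M) (Var 0))) (Arr A B).
Proof.
move=> hM; apply/ht_lam/(ht_app (A := A)); last exact: ht_var.
exact: has_type_rename hM _.
Qed.

Lemma beta_eta_typed G M N A :
  beta_eta G M N A -> has_type G M A /\ has_type G N A.
Proof.
elim=> {G M N A} //.
- by move=> G M N A _ [].
- by move=> G M N P A _ [? _] _ [].
- by move=> G M M' N N' A B _ [? ?] _ [? ?]; split; apply: ht_app; eassumption.
- by move=> G M M' A B _ [? ?]; split; apply: ht_lam.
- move=> G M N A B hM hN; split; last exact: has_type_subst1 hM hN.
  by apply: ht_app hN; apply: ht_lam.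
- by move=> G M A B hM; split=> //; apply: has_type_eta.
Qed.

(** [App] does not record the type of its argument, which the interpretation needs; on ill-typed
    terms the result is arbitrary. *)
Fixpoint ty_of (G : ctx) (M : tm) : ty :=
  match M with
  | Var x => odflt Base (lookup G x)
  | App M N => if ty_of G M is Arr _ B then B else Base
  | Lam A M => Arr A (ty_of (Some A :: G) M)
  end.

Lemma ty_ofE G M A : has_type G M A -> ty_of G M = A.
Proof.
elim=> {G M A} /=; first by move=> G x A ->.
- by move=> G M N A B _ ->.
- by move=> G M A B _ <-.
Qed.

(** * The standard model over words *)

Fixpoint D (A : ty) : Type := if A is Arr A1 A2 then D A1 -> D A2 else word.

Fixpoint dflt (A : ty) : D A :=
  match A with Base => [::] | Arr _ A2 => fun=> dflt A2 end.

Definition ty_eq_dec (A B : ty) : {A = B} + {A <> B}.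
Proof. decide equality. Defined.

(* A valuation assigns to a variable a value at every type; only the value at
   its declared type matters.  This avoids dependent contexts. *)
Definition env : Type := nat -> forall A, D A.

Definition ext (rho : env) (A : ty) (a : D A) (x : nat) : forall B, D B :=
  if x is y.+1 then rho y
  else fun B => if ty_eq_dec A B is left e then eq_rect A D a B e else dflt B.

Lemma ext0 rho A (a : D A) : ext rho a 0 A = a.
Proof.
rewrite /=; case: (ty_eq_dec A A) => [e|//].
by rewrite (UIP_dec ty_eq_dec e erefl).
Qed.

(** The type is an input, which makes the interpretation total on raw terms; a [Lam] at type [Base]
    gets a junk value. *)
Fixpoint sem (G : ctx) (M : tm) (A : ty) (rho : env) : D A :=
  match M with
  | Var x => rho x A
  | App M N => sem G M (Arr (ty_of G N) A) rho (sem G N (ty_of G N) rho)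
  | Lam C M =>
      match A with
      | Base => [::]
      | Arr A1 A2 => fun a => sem (Some C :: G) M A2 (ext rho a)
      end
  end.

Lemma sem_appE G M N A B rho : has_type G N A ->
  sem G (App M N) B rho = sem G M (Arr A B) rho (sem G N A rho).
Proof. by move=> hN /=; rewrite (ty_ofE hN). Qed.

Lemma sem_rename G D r M A rho rho' :
  has_type D M A ->
  (forall x B, lookup D x = Some B ->
     lookup G (r x) = Some B /\ rho (r x) B = rho' x B) ->
  sem G (rename r M) A rho = sem D M A rho'.
Proof.
move=> hM; elim: hM G r rho rho' => {D M A}.
- by move=> D x A hx G r rho rho' /(_ _ _ hx) [].
- move=> D M N A B _ IHM hN IHN G r rho rho' hr.
  have hN' : has_type G (rename r N) A.
    by apply: has_type_rename hN _ => x C /hr [].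
  by rewrite /= (ty_ofE hN) (ty_ofE hN') (IHM _ _ _ _ hr) (IHN _ _ _ _ hr).
- move=> D M A B _ IH G r rho rho' hr /=.
  apply: functional_extensionality => a; apply: IH => -[|x] C /=; last exact: hr.
  by case=> <-.
Qed.

Lemma sem_weak G D M A rho :
  ctx_sub G D -> has_type G M A -> sem D M A rho = sem G M A rho.
Proof.
move=> hGD hM; rewrite -{1}(@rename_fix id M) //.
by apply: sem_rename hM _ => x B /hGD.
Qed.

Lemma sem_closed G M A rho rho' :
  has_type [::] M A -> sem G M A rho = sem [::] M A rho'.
Proof.
move=> hM; rewrite -{1}(@rename_fix id M) //.
by apply: sem_rename hM _ => x B; rewrite /lookup nth_nil.
Qed.

Lemma sem_subst G D s M A rho rho' :
  has_type D M A ->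
  (forall x B, lookup D x = Some B ->
     has_type G (s x) B /\ sem G (s x) B rho = rho' x B) ->
  sem G (subst s M) A rho = sem D M A rho'.
Proof.
move=> hM; elim: hM G s rho rho' => {D M A}.
- by move=> D x A hx G s rho rho' /(_ _ _ hx) [].
- move=> D M N A B _ IHM hN IHN G s rho rho' hs.
  have hN' : has_type G (subst s N) A.
    by apply: has_type_subst hN _ => x C /hs [].
  by rewrite /= (ty_ofE hN) (ty_ofE hN') (IHM _ _ _ _ hs) (IHN _ _ _ _ hs).
- move=> D M A B _ IH G s rho rho' hs /=.
  apply: functional_extensionality => a; apply: IH => -[|x] C /= hx.
    by split=> //; apply: ht_var.
  have [hT <-] := hs _ _ hx; split; first exact: has_type_rename hT _.
  exact: sem_rename hT _.
Qed.

(** Soundness: beta is the substitution lemma; the rules for [Lam] and eta rest on functional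
    extensionality. *)
Lemma sem_beta_eta G M N A rho :
  beta_eta G M N A -> sem G M A rho = sem G N A rho.
Proof.
move=> h; elim: h rho => {G M N A} //.
- by move=> G M N P A _ IH1 _ IH2 rho; rewrite IH1.
- move=> G M M' N N' A B _ IHM hN IHN rho.
  have [h h'] := beta_eta_typed hN.
  by rewrite (sem_appE _ _ _ h) (sem_appE _ _ _ h') IHM IHN.
- move=> G M M' A B _ IH rho /=.
  by apply: functional_extensionality => a; apply: IH.
- move=> G M N A B hM hN rho; rewrite (sem_appE _ _ _ hN) /=.
  symmetry; apply: sem_subst hM _ => -[|x] C /=.
    by case=> <-; rewrite -/(ext rho (sem G N A rho) 0 A) ext0.
  by move=> hx; split=> //; apply: ht_var.
- move=> G M A B hM rho; apply: functional_extensionality => a.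
  rewrite [LHS]/= -/(ext rho a 0 A) ext0.
  by congr (_ a); apply: sem_rename hM _.
Qed.

(** * Values of encoded words and of iterated applications *)

Definition step (T : Type) (u v : T -> T) (c : letter) : T -> T :=
  if c is La then u else v.

Lemma has_type_enc G w : has_type G (enc w) word_ty.
Proof.
have var G' x A : lookup G' x = Some A -> has_type G' (Var x) A := @ht_var G' x A.
elim: w G => [|[] w IH] G; do 3![apply: ht_lam]; first exact: var.
- apply: (ht_app (A := Base)); first exact: var.
  do 3![apply: ht_app; last exact: var]; exact: IH.
- apply: (ht_app (A := Base)); first exact: var.
  do 3![apply: ht_app; last exact: var]; exact: IH.
Qed.

Lemma sem_enc G w rho (u v : word -> word) (x : word) :
  sem G (enc w) word_ty rho u v x = foldr (step u v) x w.
Proof.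
elim: w G rho u v x => [|[] w IH] G rho u v x //=.
  rewrite (ty_ofE (has_type_enc _ w)) /=; congr u; exact: IH.
rewrite (ty_ofE (has_type_enc _ w)) /=; congr v; exact: IH.
Qed.

Lemma foldr_step_cons w y : foldr (step (cons La) (cons Lb)) y w = w ++ y.
Proof. by elim: w => [|[] w /= ->]. Qed.

Fixpoint dapps (n : nat) (A B : ty) (vs : seq (D A)) :
    D (arrows (nseq n A) B) -> D B :=
  if n is n'.+1 then fun f => @dapps n' A B (behead vs) (f (head (dflt A) vs))
  else id.

Lemma sem_apps G n A B M Ns rho :
  size Ns = n -> (forall N, List.In N Ns -> has_type G N A) ->
  sem G (apps M Ns) B rho
  = dapps [seq sem G N A rho | N <- Ns] (sem G M (arrows (nseq n A) B) rho).
Proof.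
elim: n M Ns => [|n IH] M [|N Ns] //= [hs] hN.
rewrite [LHS]IH //; last by move=> P hP; apply: hN; right.
by rewrite (sem_appE _ _ _ (hN N _)) //; left.
Qed.

Lemma has_type_apps G n A B M Ns :
  size Ns = n -> (forall N, List.In N Ns -> has_type G N A) ->
  has_type G M (arrows (nseq n A) B) -> has_type G (apps M Ns) B.
Proof.
elim: n M Ns => [|n IH] M [|N Ns] //= [hs] hN hM.
apply: IH => //; first by move=> P hP; apply: hN; right.
by apply: ht_app hM (hN _ _); left.
Qed.

Lemma in_encs (xs : seq word) N :
  List.In N (map enc xs) -> has_type [::] N word_ty.
Proof.
by elim: xs => [//|x xs IH] /= [<-|/IH //]; apply: has_type_enc.
Qed.

Lemma ctx_ext_cons G A As : ctx_ext G (A :: As) = ctx_ext (Some A :: G) As.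
Proof. by rewrite /ctx_ext /= rev_cons cat_rcons. Qed.

Lemma has_type_lams G As M B :
  has_type (ctx_ext G As) M B -> has_type G (lams As M) (arrows As B).
Proof.
elim: As G => [|A As IH] G //=; rewrite ctx_ext_cons => hM.
by apply: ht_lam; apply: IH.
Qed.

(* Typing of safe and almost safe terms *)
Scheme safe_mut := Minimality for safe Sort Prop
with asafe_mut := Minimality for asafe Sort Prop.
Combined Scheme safe_asafe_ind from safe_mut, asafe_mut.

Lemma safe_asafe_typed :
  (forall G M A, safe G M A -> has_type G M A) /\
  (forall G M A, asafe G M A -> has_type G M A).
Proof.
apply: safe_asafe_ind => //.
- by move=> x A; apply: ht_var; rewrite /lookup /ctx1 nth_ncons ltnn subnn.
- by move=> G D M A hGD _; apply: has_type_weak.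
- by move=> G M N A B _ hM _ hN _; apply: ht_app hM hN.
- by move=> G As M B _ _ hM _; apply: has_type_lams.
- by move=> G M N A B _ hM _ hN; apply: ht_app hM hN.
Qed.

(** * Safe terms denote functions of the class *)

(** The boolean tag provides two copies of each argument tuple. *)
Definition point (n : nat) : Type := (n.-tuple word * bool)%type.

Definition world (n : nat) : Type := (point n -> word) -> Prop.

Definition is_base (A : ty) : bool := if A is Base then true else false.

(* The quantification over S' extending S accounts for ground variables bound
   later; an argument of order at least 1 may not depend on any of them. *)
Fixpoint tame (n : nat) (A : ty) (S : world n) : (point n -> D A) -> Prop :=
  match A with
  | Base => fun f => exists p s,
      [/\ lambda_safe_def p, S s & forall i, f i = p i.1 ++ s i]
  | Arr A1 A2 => fun f => forall S' : world n, (forall s, S s -> S' s) ->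
      forall a : point n -> D A1,
      (if is_base A1 then tame S' a else forall S'' : world n, tame S'' a) ->
      tame S' (fun i => f i (a i))
  end.

(** This is the condition on arguments in [tame], written out there because of the recursion. *)
Definition adm (n : nat) (A : ty) (S : world n) (a : point n -> D A) : Prop :=
  if is_base A then tame S a else forall S' : world n, tame S' a.

(** No induction on the type: the arrow clause already ranges over all larger worlds. *)
Lemma tame_mono n A (S S' : world n) (f : point n -> D A) :
  (forall s, S s -> S' s) -> tame S f -> tame S' f.
Proof.
case: A f => [|A B] f hS /=.
  by move=> [p [s [hp hs hf]]]; exists p, s; split=> //; apply: hS.
by move=> hf S'' hS' a; apply: hf => s /hS /hS'.
Qed.

Lemma adm_mono n A (S S' : world n) (f : point n -> D A) :
  (forall s, S s -> S' s) -> adm S f -> adm S' f.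
Proof. by rewrite /adm; case: is_base => // hS; apply: tame_mono. Qed.

Lemma adm_tame n A (S : world n) (f : point n -> D A) : adm S f -> tame S f.
Proof. by rewrite /adm; case: is_base. Qed.

(** Only free variables count, so the condition is vacuous for a closed term in any context. *)
Definition adm_env n G M (S : world n) (rho : point n -> env) : Prop :=
  forall x A, free x M -> lookup G x = Some A -> adm S (fun i => rho i x A).

(** Each binder moves to the larger world given by the arrow clause; the earlier variables follow by
    monotonicity. *)
Lemma tame_lams n G As M B :
  (forall (S : world n) rho, adm_env (ctx_ext G As) M S rho ->
     tame S (fun i => sem (ctx_ext G As) M B (rho i))) ->
  forall (S : world n) rho, adm_env G (lams As M) S rho ->
    tame S (fun i => sem G (lams As M) (arrows As B) (rho i)).
Proof.
elim: As G => [|A As IH] G hM //=.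
rewrite ctx_ext_cons in hM.
move=> S rho hrho S' hS a ha; apply: (IH (Some A :: G) hM S').
case=> [|x] C hx /=.
  case=> <-; suff -> : (fun i => ext (rho i) (a i) 0 A) = a by [].
  by apply: functional_extensionality => i; apply: ext0.
by move=> hC; apply: adm_mono hS _; apply: hrho.
Qed.

(** Fundamental lemma. A safe term of higher type is tame in every world and may thus serve as an
    argument; an almost safe one is tame only in the world of its variables. *)
Lemma safe_asafe_tame n :
  (forall G M A, safe G M A -> forall (S : world n) rho,
     adm_env G M S rho -> adm S (fun i => sem G M A (rho i))) /\
  (forall G M A, asafe G M A -> forall (S : world n) rho,
     adm_env G M S rho -> tame S (fun i => sem G M A (rho i))).
Proof.
have [safeT asafeT] := safe_asafe_typed.
have app_tame G M N A B :
    asafe G M (Arr A B) ->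
    (forall (S : world n) rho, adm_env G M S rho ->
       tame S (fun i => sem G M (Arr A B) (rho i))) ->
    safe G N A ->
    (forall (S : world n) rho, adm_env G N S rho ->
       adm S (fun i => sem G N A (rho i))) ->
    forall (S : world n) rho, adm_env G (App M N) S rho ->
      tame S (fun i => sem G (App M N) B (rho i)).
  move=> hM IHM hN IHN S rho hrho /=.
  rewrite (ty_ofE (safeT _ _ _ hN)).
  apply: (IHM S rho) => //.
    by move=> x C hx; apply: hrho; left.
  by apply: IHN => x C hx; apply: hrho; right.
(* Here safety enters: the side condition leaves no ground variable in the context, and
   admissibility at higher type does not depend on the world. *)
have nonground G M B (S S' : world n) rho :
    ~~ is_base B -> le_ord (ord B) G -> adm_env G M S rho -> adm_env G M S' rho.
  move=> hB hG hrho x A hx hA; have := hrho x A hx hA; have := hG x A hA.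
  rewrite /adm; case: A hA => //= hA.
  by case: B hB hG => // B1 B2 _ _ /=; rewrite leqn0 gtn_eqF // leq_max.
apply: safe_asafe_ind => //.
- by move=> x A S rho hrho; apply: hrho; rewrite /= ?/lookup ?nth_ncons ?ltnn ?subnn.
- move=> G D' M A hGD hM IH S rho hrho.
  have -> : (fun i => sem D' M A (rho i)) = (fun i => sem G M A (rho i)).
    by apply: functional_extensionality => i; apply: sem_weak (safeT _ _ _ hM).
  by apply: IH => x B hx /hGD; apply: hrho.
- move=> G M N A B hM IHM hN IHN hG S rho hrho; rewrite /adm.
  case: (boolP (is_base B)) => hB; first exact: app_tame hM IHM hN IHN _ _ hrho.
  by move=> S'; apply: app_tame hM IHM hN IHN _ _ (nonground _ _ _ _ _ _ hB hG hrho).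
- move=> G As M B hAs hM IHM hG S rho hrho.
  have hB : ~~ is_base (arrows As B) by case: As hAs {hM IHM hG hrho}.
  rewrite /adm (negbTE hB) => S'.
  by apply: tame_lams IHM _ _ (nonground _ _ _ _ _ _ hB hG hrho).
- by move=> G M A _ IH S rho /IH /adm_tame.
Qed.

(** * Closure properties of the class and tameness of encoded arguments *)

Lemma lsd_cat n (p q : word_fun n) : 0 < n ->
  lambda_safe_def p -> lambda_safe_def q ->
  lambda_safe_def (fun xs => p xs ++ q xs).
Proof.
move=> n_gt0 hp hq.
pose f (i : 'I_2) : word_fun n := if i == ord0 then p else q.
apply: lsd_ext (lsd_comp (f := f) (isT : 0 < 2) n_gt0 lsd_app _).
  by move=> xs; rewrite /= !enum_ordSl.
by move=> i; rewrite /f; case: eqP.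
Qed.

Lemma lsd_sub_comp n (p q r : word_fun n) : 0 < n ->
  lambda_safe_def p -> lambda_safe_def q -> lambda_safe_def r ->
  lambda_safe_def (fun xs => sub (p xs) (q xs) (r xs)).
Proof.
move=> n_gt0 hp hq hr.
pose f (i : 'I_3) : word_fun n :=
  if i == ord0 then p else if i == ord_max then r else q.
apply: lsd_ext (lsd_comp (f := f) (isT : 0 < 3) n_gt0 lsd_sub _).
  by move=> xs; rewrite /= !enum_ordSl.
by move=> i; rewrite /f; case: eqP => // _; case: eqP.
Qed.

(** The generating constants are unary; they are composed with the first projection. *)
Lemma lsd_const n (w : word) : 0 < n -> lambda_safe_def (fun _ : n.-tuple word => w).
Proof.
case: n => // n _.
apply: (lsd_comp (f := fun _ xs => tnth xs ord0) _ _ (lsd_cst w)) => //.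
by move=> _; apply: lsd_proj.
Qed.

(* The two copies of each argument tuple are what makes the prefix [p]
   independent of the tail: the tails may differ in the two copies, but the
   prefix may not. *)
Lemma adm_oo n (S : world n) (f : point n -> D oo) : 0 < n -> adm S f ->
  exists2 p, lambda_safe_def p & forall i t, f i t = p i.1 ++ t.
Proof.
move=> n_gt0 hf.
(* In the world whose only tail is [s], the family [s] is good with empty prefix, so [f] can only
   put a prefix before it. *)
have pre s : exists2 p, lambda_safe_def p & forall i, f i (s i) = p i.1 ++ s i.
  have [||p [s' [hp -> hp']]] := hf (eq s) (eq s) _ s => //; last by exists p.
  by exists (fun=> [::]), s; split=> //; apply: lsd_const.
have [p hp hpE] := pre (fun=> [::]); exists p => // -[xs b] t.
(* The tail is [t] on copy [b] and empty on the other copy, where comparison with [p] gives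
   [q xs = p xs]. *)
have [q _ hq] := pre (fun i => if i.2 == b then t else [::]).
have e : p xs = q xs.
  have := hq (xs, ~~ b).
  by rewrite /= (_ : (~~ b == b) = false) ?hpE ?cats0 //; case: (b).
by have := hq (xs, b); rewrite /= eqxx e.
Qed.

Lemma adm_enc n G rho (k : 'I_n) (S : world n) : 0 < n ->
  adm S (fun i => sem G (enc (tnth i.1 k)) word_ty rho).
Proof.
move=> n_gt0 S1 S2 _ f hf S3 _ g hg S4 _ m [r [s [hr hs hm]]].
have [p hp hpE] := adm_oo (S := S) n_gt0 hf.
have [q hq hqE] := adm_oo (S := S) n_gt0 hg.
(* [f] and [g] prefix [p] and [q], and the iteration starts from [r] followed by the tail [s]. *)
exists (fun xs => sub (tnth xs k) (p xs) (q xs) ++ r xs), s; split=> //.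
  by apply: lsd_cat => //; apply: lsd_sub_comp => //; apply: lsd_proj.
move=> i; rewrite sem_enc hm -catA.
by elim: (tnth i.1 k) => [|[] w IH] //=; rewrite IH ?hpE ?hqE catA.
Qed.

Lemma tame_dapps n k A B (S : world n) (vs : point n -> seq (D A))
    (f : point n -> D (arrows (nseq k A) B)) :
  tame S f -> (forall j, j < k -> adm S (fun i => nth (dflt A) (vs i) j)) ->
  tame S (fun i => dapps (vs i) (f i)).
Proof.
elim: k vs f => [|k IH] vs f hf hvs //=.
apply: (IH (fun i => behead (vs i)) (fun i => f i (head (dflt A) (vs i)))).
  apply: hf => //.
  have -> : (fun i => head (dflt A) (vs i)) = fun i => nth (dflt A) (vs i) 0.
    by apply: functional_extensionality => i; rewrite nth0.
  exact: hvs.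
move=> j hj.
have -> : (fun i => nth (dflt A) (behead (vs i)) j) = fun i => nth (dflt A) (vs i) j.+1.
  by apply: functional_extensionality => i; rewrite nth_behead.
exact: hvs.
Qed.

Definition rho0 : env := fun _ A => dflt A.

(** Decoding: the two iterated maps prefix a letter, starting from the empty word. *)
Definition eval_word (M : tm) : word :=
  sem [::] M word_ty rho0 (cons La) (cons Lb) [::].

Lemma eval_enc w : eval_word (enc w) = w.
Proof. by rewrite /eval_word sem_enc foldr_step_cons cats0. Qed.

Lemma safe_definable_lsd n (h : word_fun n) : 0 < n ->
  safe_definable h -> lambda_safe_def h.
Proof.
move=> n_gt0 [H [[G [A hH]] [hT hrep]]].
have [safeT _] := safe_asafe_typed.
(* The safety derivation comes with its own context and type; uniqueness of types identifies the
   latter. *)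
have eA : A = arrows (nseq n word_ty) word_ty.
  by rewrite -(ty_ofE (safeT _ _ _ hH)) (ty_ofE (has_type_closed G hT)).
subst A.
(* With the empty word as only tail, a good family of words is just its prefix, a function of the
   class. *)
pose S : world n := eq (fun=> [::]).
pose P := arrows (nseq n word_ty) word_ty.
have hHS : tame S (fun _ => sem [::] H P rho0).
  have := (safe_asafe_tame n).1 _ _ _ hH S (fun=> rho0).
  rewrite (sem_closed G rho0 rho0 hT) => hadm; apply: adm_tame; apply: hadm.
  by move=> x C /(closed_free hT).
pose vs (i : point n) := [seq sem [::] N word_ty rho0 | N <- map enc i.1].
have hvs j : j < n -> adm S (fun i => nth (dflt word_ty) (vs i) j).
  move=> hj.
  have -> : (fun i => nth (dflt word_ty) (vs i) j)
          = (fun i => sem [::] (enc (tnth i.1 (Ordinal hj))) word_ty rho0).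
    apply: functional_extensionality => i; rewrite /vs -map_comp.
    by rewrite (nth_map [::]) ?size_tuple //= (tnth_nth [::]).
  exact: adm_enc.
have hres := tame_dapps (vs := vs) hHS hvs.
(* The arguments used for decoding are admissible because the class contains constants and
   concatenation. *)
have step_adm c : @adm n oo S (fun=> cons c).
  move=> S1 S2 _ a [p [s [hp hs ha]]].
  exists (fun xs => [:: c] ++ p xs), s; split=> // [|i]; last by rewrite ha.
  by apply: lsd_cat => //; apply: lsd_const.
have nil_tame : @tame n Base S (fun=> [::]).
  by exists (fun=> [::]), (fun=> [::]); split=> //; apply: lsd_const.
have [p [s [hp <- hE]]] := hres S (fun _ => id) (fun=> cons La) (step_adm La)
  S (fun _ => id) (fun=> cons Lb) (step_adm Lb) S (fun _ => id) _ nil_tame.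
apply: lsd_ext hp => xs; rewrite -[h xs]eval_enc /eval_word.
rewrite -(sem_beta_eta rho0 (hrep xs)) (sem_apps (n := n) (A := word_ty)).
- by rewrite -[LHS]cats0 -(hE (xs, true)).
- by rewrite size_map size_tuple.
- exact: in_encs.
Qed.

(** * Functions of the class are safely definable *)

Definition uvx : ctx := ctx_ext [::] [:: oo; oo; Base].

(** The beta-normal form of the body of [enc w] under its three binders. *)
Definition word_body (w : word) : tm :=
  foldr (step (App (Var 2)) (App (Var 1))) (Var 0) w.

(** A logical relation in the single context [uvx], where [u] and [v] stand for prefixing a letter
    and [x] for the empty word. *)
Fixpoint realizes (A : ty) : tm -> D A -> Prop :=
  match A with
  | Base => fun t w => beta_eta uvx t (word_body w) Base
  | Arr A1 A2 => fun t f => has_type uvx t (Arr A1 A2) /\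
      forall a e, realizes a e -> realizes (App t a) (f e)
  end.

Lemma realizes_typed A t (d : D A) : realizes t d -> has_type uvx t A.
Proof. by case: A d => [|A B] d /=; [case/beta_eta_typed | case]. Qed.

Lemma realizes_conv A t t' (d : D A) :
  beta_eta uvx t t' A -> realizes t' d -> realizes t d.
Proof.
elim: A t t' d => [|A _ B IH] t t' d htt /=; first exact: be_trans.
move=> [_ h]; split=> [|a e ha]; first by case: (beta_eta_typed htt).
apply: IH (h a e ha); apply: (be_app htt); apply: be_refl; exact: realizes_typed ha.
Qed.

(** Fundamental lemma of the relation; abstractions use its closure under beta-expansion. *)
Lemma realizes_subst G M A s rho :
  has_type G M A ->
  (forall x B, lookup G x = Some B -> realizes (s x) (rho x B)) ->
  realizes (subst s M) (sem G M A rho).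
Proof.
move=> hM; elim: hM s rho => {G M A}.
- by move=> G x A hx s rho; apply.
- move=> G M N A B _ IHM hN IHN s rho hs; rewrite (sem_appE _ _ _ hN).
  exact: (IHM s rho hs).2 (IHN s rho hs).
- move=> G M A B hM IH s rho hs.
  have hL : has_type uvx (subst s (Lam A M)) (Arr A B).
    by apply: has_type_subst (ht_lam hM) _ => x C /hs /realizes_typed.
  split=> // a e ha; apply: (realizes_conv (t' := subst (scons a s) M)).
    rewrite -subst1_up_subst; apply: be_beta (realizes_typed ha).
    by inversion hL.
  apply: IH => -[|x] C /= hx; last exact: hs.
  by case: hx => <-; rewrite -/(ext rho e 0 A) ext0.
Qed.

(** Apply the fundamental lemma to [M] and to the variables [u], [v], [x], which realize the
    arguments used by [eval_word]. *)
Lemma closed_word_body M : has_type [::] M word_ty ->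
  beta_eta uvx (apps M [:: Var 2; Var 1; Var 0]) (word_body (eval_word M)) Base.
Proof.
move=> hM.
have var x A : lookup uvx x = Some A -> has_type uvx (Var x) A := @ht_var _ x A.
have letter_realizes x c : lookup uvx x = Some oo ->
    (forall w, App (Var x) (word_body w) = word_body (c :: w)) ->
    @realizes oo (Var x) (cons c).
  move=> hx hc; split=> [|t w htw]; first exact: var.
  change (beta_eta uvx (App (Var x) t) (word_body (c :: w)) Base).
  by rewrite -hc; apply: be_app htw; apply: be_refl; apply: var.
have [_] : @realizes word_ty M (sem [::] M word_ty rho0).
  rewrite -{1}(@subst_fix Var M) //; apply: realizes_subst hM _ => x B.
  by rewrite /lookup nth_nil.
move=> /(_ _ _ (letter_realizes 2 La _ _)) [//|//|_].
move=> /(_ _ _ (letter_realizes 1 Lb _ _)) [//|//|_].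
by apply; apply: be_refl; apply: var.
Qed.

Lemma closed_word_eta M : has_type [::] M word_ty ->
  beta_eta [::] (lams [:: oo; oo; Base] (apps M [:: Var 2; Var 1; Var 0])) M word_ty.
Proof.
move=> hM.
have fix_M r : rename r M = M by apply: rename_fix => x /(closed_free hM).
have hG G : has_type G M word_ty := has_type_closed G hM.
have var G x A : lookup G x = Some A -> has_type G (Var x) A := @ht_var G x A.
apply: be_trans (be_eta hM); rewrite fix_M; apply: be_lam.
have h1 : has_type [:: Some oo] (App M (Var 0)) (arrows [:: oo; Base] Base).
  by apply: ht_app (hG _) _; apply: var.
apply: be_trans (be_eta h1); rewrite /= fix_M; apply: be_lam.
have h2 : has_type [:: Some oo; Some oo] (App (App M (Var 1)) (Var 0)) oo.
  by do 2![apply: ht_app; last exact: var]; apply: hG.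
by have := be_eta h2; rewrite /= fix_M.
Qed.

(** Both terms eta-expand to abstractions whose bodies convert to the same [word_body]. *)
Lemma closed_word_complete M N :
  has_type [::] M word_ty -> has_type [::] N word_ty ->
  eval_word M = eval_word N -> beta_eta [::] M N word_ty.
Proof.
move=> hM hN e.
apply: be_trans (closed_word_eta hN); apply: be_trans (be_sym (closed_word_eta hM)) _.
do 3![apply: be_lam]; apply: be_trans (closed_word_body hM) _.
by rewrite e; apply/be_sym/closed_word_body.
Qed.

Lemma represents_eval n (H : tm) (h : word_fun n) :
  has_type [::] H (arrows (nseq n word_ty) word_ty) ->
  (forall xs : n.-tuple word, eval_word (apps H (map enc xs)) = h xs) ->
  represents H h.
Proof.
move=> hH he; split=> // xs; apply: closed_word_complete.
- apply: has_type_apps hH; first by rewrite size_map size_tuple.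
  exact: in_encs.
- exact: has_type_enc.
- by rewrite he eval_enc.
Qed.

(** * Values and safety of iterated abstractions and applications *)

Definition exts A (rho : env) (vs : seq (D A)) : env :=
  foldl (fun r v => ext r v) rho vs.

Lemma extsE A rho (vs : seq (D A)) x :
  x < size vs -> exts rho vs x A = nth (dflt A) (rev vs) x.
Proof.
elim/last_ind: vs x => [|vs v IH] x //.
rewrite size_rcons rev_rcons /exts foldl_rcons.
case: x => [|x] hx; first exact: ext0.
exact: IH.
Qed.

Lemma dapps_lams G n A B M rho (vs : seq (D A)) : size vs = n ->
  dapps vs (sem G (lams (nseq n A) M) (arrows (nseq n A) B) rho)
  = sem (ctx_ext G (nseq n A)) M B (exts rho vs).
Proof.
elim: n G rho vs => [|n IH] G rho [|v vs] //= [hs].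
by rewrite ctx_ext_cons -IH.
Qed.

Lemma safe_lookup G x A : lookup G x = Some A -> safe G (Var x) A.
Proof.
move=> hx; apply: safe_wk (safe_var x A) => y B.
rewrite /lookup /ctx1 nth_ncons; case: ltnP => // hxy.
case hd: (y - x) => [|d] /=; last by rewrite nth_nil.
by move=> [<-]; have -> : y = x by apply/eqP; rewrite eqn_leq hxy -subn_eq0 hd.
Qed.

Lemma safe_closed G M A : safe [::] M A -> safe G M A.
Proof. by apply: safe_wk => x B; rewrite /lookup nth_nil. Qed.

(** Only the last application needs the order condition; the earlier ones stay almost safe. *)
Lemma safe_apps G n A B M Ns : 0 < n -> size Ns = n -> le_ord (ord B) G ->
  asafe G M (arrows (nseq n A) B) -> (forall N, List.In N Ns -> safe G N A) ->
  safe G (apps M Ns) B.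
Proof.
case: n => // n _; elim: n M Ns => [|n IH] M [|N Ns] //= [hs] hB hM hN.
  by case: Ns hs hN => //= _ hN; apply: (safe_app hM _ hB); apply: hN; left.
apply: IH => //; last by move=> P hP; apply: hN; right.
by apply: asafe_app hM (hN _ _); left.
Qed.

Lemma le_ord_nil c : le_ord c [::].
Proof. by move=> x A; rewrite /lookup nth_nil. Qed.

Lemma le_ord0 G : le_ord 0 G. Proof. by []. Qed.

Lemma asafe_lookup G x A : lookup G x = Some A -> asafe G (Var x) A.
Proof. by move=> hx; apply/asafe_delta/safe_lookup. Qed.

Lemma safe_word_app G M U V X : asafe G M word_ty ->
  safe G U oo -> safe G V oo -> safe G X Base ->
  safe G (apps M [:: U; V; X]) Base.
Proof.
move=> hM hU hV hX; apply: safe_app (asafe_app (asafe_app hM hU) hV) hX _; exact: le_ord0.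
Qed.

Lemma safe_enc G w : safe G (enc w) word_ty.
Proof.
elim: w G => [|[] w IH] G; apply: safe_closed;
  apply: (@safe_abs [::] [:: oo; oo; Base] _ Base) => //; try exact: le_ord_nil.
- exact: asafe_lookup.
- apply: (asafe_app (A := Base)); first exact: asafe_lookup.
  by apply: safe_word_app (asafe_delta (IH _)) _ _ _; apply: safe_lookup.
- apply: (asafe_app (A := Base)); first exact: asafe_lookup.
  by apply: safe_word_app (asafe_delta (IH _)) _ _ _; apply: safe_lookup.
Qed.

(** * Safe terms for concatenation and substitution *)

Lemma safe_eval_represents n (h : word_fun n) H :
  safe [::] H (arrows (nseq n word_ty) word_ty) ->
  (forall xs : n.-tuple word, eval_word (apps H (map enc xs)) = h xs) ->
  exists2 H', safe [::] H' (arrows (nseq n word_ty) word_ty) & represents H' h.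
Proof.
move=> hs he; exists H => //; apply: represents_eval he.
exact: (proj1 safe_asafe_typed).
Qed.

(** With names: [\y z u v x. y u v (z u v x)]. *)
Definition cat_tm : tm :=
  lams [:: word_ty; word_ty; oo; oo; Base]
    (apps (Var 4) [:: Var 2; Var 1; apps (Var 3) [:: Var 2; Var 1; Var 0]]).

(** With names: [\x y z u v t. x (y u v) (z u v) t]. *)
Definition sub_tm : tm :=
  lams [:: word_ty; word_ty; word_ty; oo; oo; Base]
    (apps (Var 5) [:: apps (Var 4) [:: Var 2; Var 1];
                      apps (Var 3) [:: Var 2; Var 1]; Var 0]).

Lemma safe_cat_tm : safe [::] cat_tm (arrows (nseq 2 word_ty) word_ty).
Proof.
apply: (@safe_abs [::] [:: word_ty; word_ty; oo; oo; Base] _ Base) => //;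
  last exact: le_ord_nil.
apply/asafe_delta/safe_word_app; try exact: safe_lookup.
  exact: asafe_lookup.
apply: safe_word_app; try exact: safe_lookup.
exact: asafe_lookup.
Qed.

Lemma safe_sub_tm : safe [::] sub_tm (arrows (nseq 3 word_ty) word_ty).
Proof.
apply: (@safe_abs [::] [:: word_ty; word_ty; word_ty; oo; oo; Base] _ Base) => //;
  last exact: le_ord_nil.
set G := ctx_ext _ _.
(* The partial applications to [u] and [v] have order 1, so they are formed without the ground
   variable; [None] keeps the other indices in place. *)
pose G' : ctx := [:: None; Some oo; Some oo; Some word_ty; Some word_ty; Some word_ty].
have G'_ord : le_ord 1 G'.
  by move=> [|[|[|[|[|[|y]]]]]] A; rewrite /lookup /= ?nth_nil // => -[<-].
have image x : lookup G' x = Some word_ty ->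
    safe G (apps (Var x) [:: Var 2; Var 1]) oo.
  move=> hx; apply: (@safe_wk G'); first by case.
  apply: (@safe_app _ _ _ oo oo _ _ G'_ord); last exact: safe_lookup.
  apply: (@asafe_app _ _ _ oo); first exact: asafe_lookup.
  exact: safe_lookup.
apply/asafe_delta/safe_word_app; try exact: image; last exact: safe_lookup.
exact: asafe_lookup.
Qed.

Lemma eval_cat_tm x y : eval_word (apps cat_tm [:: enc x; enc y]) = x ++ y.
Proof.
rewrite /eval_word (sem_apps (n := 2) (A := word_ty)) //; last first.
  exact: (@in_encs [:: x; y]).
by rewrite /= !sem_enc !foldr_step_cons cats0.
Qed.

Lemma eval_sub_tm x y z :
  eval_word (apps sub_tm [:: enc x; enc y; enc z]) = sub x y z.
Proof.
rewrite /eval_word (sem_apps (n := 3) (A := word_ty)) //; last first.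
  exact: (@in_encs [:: x; y; z]).
rewrite /= sem_enc.
by elim: x => [|[] x /= ->] //; rewrite sem_enc foldr_step_cons.
Qed.

(** * Safe terms for composition *)

Definition vars (p : nat) : seq tm := [seq Var (p - k.+1) | k <- iota 0 p].

Definition comp_tm (n p : nat) (Hg : tm) (Hf : 'I_n -> tm) : tm :=
  lams (nseq p word_ty) (apps Hg [seq apps (Hf i) (vars p) | i <- enum 'I_n]).

Lemma ctx_ext_nseq p A : ctx_ext [::] (nseq p A) = nseq p (Some A).
Proof. by rewrite /ctx_ext map_nseq rev_nseq cats0. Qed.

Lemma lookup_nseq p A x : x < p -> lookup (nseq p (Some A)) x = Some A.
Proof. by rewrite /lookup nth_nseq => ->. Qed.

(** The last value has index 0 and [vars] lists the indices downwards, which restores the order. *)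
Lemma sem_vars G A rho (vs : seq (D A)) :
  [seq sem G N A (exts rho vs) | N <- vars (size vs)] = vs.
Proof.
apply: (@eq_from_nth _ (dflt A)); rewrite /vars !size_map size_iota // => k hk.
rewrite (nth_map (Var 0)) ?size_map ?size_iota // (nth_map 0) ?size_iota //.
rewrite nth_iota //= extsE; last by rewrite ltn_subrL /= (leq_trans _ hk).
by rewrite nth_rev ?ltn_subrL ?(leq_trans _ hk) //= subnSK // subKn // ltnW.
Qed.

Lemma in_vars p A N : List.In N (vars p) ->
  exists2 x, N = Var x & lookup (ctx_ext [::] (nseq p A)) x = Some A.
Proof.
have in_map s : all (fun k => k < p) s -> List.In N [seq Var (p - k.+1) | k <- s] ->
    exists2 x, N = Var x & lookup (ctx_ext [::] (nseq p A)) x = Some A.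
  elim: s => [//|k s IH] /= /andP[hk hs] [<-|/(IH hs) //].
  exists (p - k.+1); rewrite // ctx_ext_nseq lookup_nseq // ltn_subrL /=.
  exact: leq_trans hk.
by apply: in_map; apply/allP => k; rewrite mem_iota.
Qed.

Lemma in_map_tm (T : Type) (F : T -> tm) s N :
  List.In N [seq F i | i <- s] -> exists i, N = F i.
Proof. by elim: s => [//|i s IH] /= [<-|/IH //]; exists i. Qed.

Lemma size_vars p : size (vars p) = p.
Proof. by rewrite size_map size_iota. Qed.

Lemma eval_comp_tm n p Hg (Hf : 'I_n -> tm) (f : 'I_n -> word_fun p)
    (xs : p.-tuple word) :
  has_type [::] Hg (arrows (nseq n word_ty) word_ty) ->
  (forall i, represents (Hf i) (f i)) ->
  eval_word (apps (comp_tm p Hg Hf) (map enc xs))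
  = eval_word (apps Hg (map enc [tuple f i xs | i < n])).
Proof.
move=> hg hf; rewrite /eval_word.
suff -> : sem [::] (apps (comp_tm p Hg Hf) (map enc xs)) word_ty rho0
  = sem [::] (apps Hg (map enc [tuple f i xs | i < n])) word_ty rho0 by [].
set vs := [seq sem [::] N word_ty rho0 | N <- map enc xs].
have size_vs : size vs = p by rewrite !size_map size_tuple.
set G := ctx_ext [::] (nseq p word_ty).
have hvars N : List.In N (vars p) -> has_type G N word_ty.
  by move=> /(@in_vars _ word_ty) [x -> hx]; apply: ht_var.
rewrite (sem_apps (n := p) (A := word_ty)); last first.
- exact: in_encs.
- by rewrite size_map size_tuple.
rewrite dapps_lams // (sem_apps (n := n) (A := word_ty)); last first.
- move=> N /in_map_tm [i ->]; apply: has_type_apps (size_vars p) hvars _.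
  exact: has_type_closed (hf i).1.
- by rewrite size_map size_enum_ord.
rewrite [RHS](sem_apps (n := n) (A := word_ty)); last first.
- exact: in_encs.
- by rewrite size_map size_tuple.
rewrite (sem_closed _ _ rho0 hg); congr dapps; rewrite /= -!map_comp.
(* By soundness [enc (f i xs)] has the value of [Hf i] applied to the encoded arguments. *)
apply: eq_map => i /=; rewrite -(sem_beta_eta rho0 ((hf i).2 xs)).
rewrite (sem_apps _ _ _ (size_vars p) hvars) (sem_closed _ _ rho0 (hf i).1).
rewrite (sem_apps (n := p) (A := word_ty)) ?size_map ?size_tuple //; last exact: in_encs.
by rewrite [X in exts _ X]map_comp -/vs -[X in vars X]size_vs sem_vars.
Qed.

(** All variables and all complete applications have type [word_ty], so the order condition holds
    with equality. *)
Lemma safe_comp_tm n p Hg (Hf : 'I_n -> tm) : 0 < n -> 0 < p ->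
  safe [::] Hg (arrows (nseq n word_ty) word_ty) ->
  (forall i, safe [::] (Hf i) (arrows (nseq p word_ty) word_ty)) ->
  safe [::] (comp_tm p Hg Hf) (arrows (nseq p word_ty) word_ty).
Proof.
move=> n_gt0 p_gt0 hg hf.
set G := ctx_ext [::] (nseq p word_ty).
have hG : le_ord (ord word_ty) G.
  move=> x A; rewrite /G ctx_ext_nseq /lookup nth_nseq.
  by case: ifP => // _ [<-].
apply: safe_abs (@le_ord_nil _); first by rewrite size_nseq.
apply: asafe_delta; apply: (safe_apps n_gt0 _ hG (asafe_delta (safe_closed G hg))).
  by rewrite size_map size_enum_ord.
move=> N /in_map_tm [i ->].
apply: (safe_apps p_gt0 (size_vars p) hG (asafe_delta (safe_closed G (hf i)))).
by move=> M /(@in_vars _ word_ty) [x -> hx]; apply: safe_lookup.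
Qed.

Lemma lsd_safe n (h : word_fun n) : lambda_safe_def h ->
  exists2 H, safe [::] H (arrows (nseq n word_ty) word_ty) & represents H h.
Proof.
elim=> {n h}.
- move=> n k; have n_gt0 : 0 < n by apply: leq_trans (ltn_ord k).
  have hk : n - k.+1 < n by rewrite ltn_subrL.
  apply: (@safe_eval_represents _ _ (lams (nseq n word_ty) (Var (n - k.+1)))).
    apply: safe_abs (@le_ord_nil _); first by rewrite size_nseq.
    by apply: asafe_lookup; rewrite ctx_ext_nseq lookup_nseq.
  move=> xs; rewrite /eval_word (sem_apps (n := n) (A := word_ty)); last first.
  - exact: in_encs.
  - by rewrite size_map size_tuple.
  have size_vs : size [seq sem [::] N word_ty rho0 | N <- map enc xs] = n.
    by rewrite !size_map size_tuple.
  rewrite dapps_lams // [sem _ (Var _) _ _]/= extsE ?size_vs //.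
  rewrite nth_rev size_vs // subnSK // subKn ?(ltnW (ltn_ord k)) // -map_comp.
  rewrite (nth_map [::]) ?size_tuple //= -/(eval_word _) eval_enc.
  by rewrite -tnth_nth.
- move=> w; apply: (@safe_eval_represents _ _ (Lam word_ty (enc w))).
    apply: (@safe_abs [::] [:: word_ty]) (@le_ord_nil _) => //.
    exact/asafe_delta/safe_enc.
  case/tupleP=> x xs; rewrite tuple0 -[RHS]eval_enc /eval_word.
  by rewrite [apps _ _]/= (sem_appE _ _ _ (has_type_enc _ x)) /= !sem_enc.
- apply: safe_eval_represents safe_cat_tm _.
  by case/tupleP=> x; case/tupleP=> y xs; rewrite tuple0 /= eval_cat_tm.
- apply: safe_eval_represents safe_sub_tm _.
  by case/tupleP=> x; case/tupleP=> y; case/tupleP=> z xs;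
    rewrite tuple0 /= eval_sub_tm.
- move=> n p g f n_gt0 p_gt0 _ [Hg hgs [hg hgE]] _ hf.
  (* Finite choice of the representing terms. *)
  have [|Hf hHf] := @fin_all_exists _ (fun=> tm) (fun i H =>
    safe [::] H (arrows (nseq p word_ty) word_ty) /\ represents H (f i)).
    by move=> i; have [H hs hr] := hf i; exists H.
  apply: (@safe_eval_represents _ _ (comp_tm p Hg Hf)).
    by apply: safe_comp_tm => // i; case: (hHf i).
  move=> xs; rewrite (eval_comp_tm (f := f)) //; last by move=> i; case: (hHf i).
  by rewrite /eval_word (sem_beta_eta rho0 (hgE _)) -/(eval_word _) eval_enc.
- move=> n f g hfg _ [H hs [hT hE]]; exists H => //; split=> // xs.
  by rewrite -hfg.
Qed.

Theorem theorem2p8 (n : nat) (h : word_fun n) (n_gt0 : 0 < n) :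
  safe_definable h <-> lambda_safe_def h.
Proof.
split; first exact: safe_definable_lsd.
move=> /lsd_safe [H hs hr]; exists H; split=> //.
by exists [::], (arrows (nseq n word_ty) word_ty).
Qed.
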